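(* Let $L_1:=L_1(1,\infty)$ and let $A$ be the bounded operator on $L_1$ given by $(Au)(s)=u(s)/s$. Let $g$ be a Stieltjes function with representation $(0,0,\mu)$ and $g(0+)=\infty$. The condition $$\int_1^\infty\frac{g(1/t)\,\|C_t(A)u\|_{L_1}}{t}\,dt<\infty$$ holds for all $u\in\mathrm{dom}(g(A))$ if and only if $g$ is integrable on $(0,1)$ and there exists $c>0$ such that $$\frac1t\int_0^t g(\tau)\,d\tau+\int_t^1\frac{g(\tau)}{\tau}\,d\tau\le c\,g(t),\qquad t\in(0,1).$$
   Context: A Stieltjes function with representation $(0,0,\mu)$ is a function $g(z)=\int_{(0,\infty)}\frac{\mu(ds)}{z+s}$, $z>0$, where $\mu$ is a positive Radon measure on $(0,\infty)$ with $\int_{(0,\infty)}\frac{\mu(ds)}{1+s}<\infty$. Here $g(0+)=\lim_{s\to0+}g(s)$. The operator $-A$ generates the contraction $C_0$-semigroup $(T(t)u)(s)=e^{-t/s}u(s)$ on $L_1$, and $C_t(A)u:=\frac1t\int_0^tT(\tau)u\,d\tau$, i.e. $(C_t(A)u)(s)=\frac{s(1-e^{-t/s})}{t}u(s)$, for $t>0$. The operator $g(A)$ (defined by the extended Hille–Phillips functional calculus) is the multiplication operator $(g(A)u)(s)=g(1/s)u(s)$ with domain $\mathrm{dom}(g(A))=\{u\in L_1:\int_1^\infty g(1/s)|u(s)|\,ds<\infty\}$. *)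

(* Defs.v *)
From mathcomp Require Import all_boot all_order all_algebra.
From mathcomp Require Import complex.
From mathcomp Require Import all_classical all_reals all_analysis.
From mathcomp Require Import ring.

Set Implicit Arguments.
Unset Strict Implicit.
Unset Printing Implicit Defensive.

Import Order.TTheory GRing.Theory Num.Theory.
Import numFieldNormedType.Exports.

Local Open Scope classical_set_scope.
Local Open Scope ring_scope.
Local Open Scope complex_scope.

Section stieltjes.
Context {R : realType}.

(* [mu] is a Borel measure on the whole line of which only the restriction to
   ]0, +oo[ is ever used.  Finiteness on compact sets is enough for it to be
   Radon there, since ]0, +oo[ is a locally compact separable metric space. *)
Definition radon_pos (mu : {measure set (measurableTypeR R) -> \bar R}) :=
  forall K : set R, compact K -> K `<=` `]0, +oo[ -> (mu K < +oo)%E.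

(* [g] is only constrained on ]0, +oo[; the equation is between extended reals,
   so it also says that the integral is finite. *)
Definition stieltjes (mu : {measure set (measurableTypeR R) -> \bar R})
    (g : R -> R) :=
  [/\ radon_pos mu,
      (\int[mu]_(s in `]0%R, +oo[) ((1 + s)^-1)%:E < +oo)%E &
      forall z, 0 < z ->
        (g z)%:E = (\int[mu]_(s in `]0%R, +oo[) ((z + s)^-1)%:E)%E].

End stieltjes.

Section operators.
Context {R : realType}.
Implicit Types (u : R -> R[i]) (g : R -> R) (t : R).

(* Elements of the complex space L_1(1, +oo) are represented by functions on
   the line; their values outside ]1, +oo[ are irrelevant. *)
Definition L1 : set (R -> R[i]) := [set u |
  lebesgue_measure.-integrable `]1, +oo[
    (EFin \o (fun s => complex.Re (u s))) /\
  lebesgue_measure.-integrable `]1, +oo[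
    (EFin \o (fun s => complex.Im (u s)))].

Definition L1norm u : \bar R :=
  (\int[lebesgue_measure]_(s in `]1%R, +oo[) (Normc.normc (u s))%:E)%E.

(* The Hille-Phillips calculus sends f to the multiplication by f(1/s), and the
   coordinate function to A itself. *)
Definition funA (f : R -> R) u : R -> R[i] := fun s => (f s^-1)%:C * u s.

Definition opA : (R -> R[i]) -> (R -> R[i]) := funA id.

Definition semigroup t : (R -> R[i]) -> (R -> R[i]) :=
  funA (fun z => expR (- (t * z))).

(* The L_1-valued integral of the orbit is computed pointwise in s, and the
   integral of a complex-valued function componentwise. *)
Definition cesaro_semigroup t u : R -> R[i] := fun s =>
  (t^-1)%:C *
  ((\int[lebesgue_measure]_(tau in `[0, t]) complex.Re (semigroup tau u s)) +i*
   (\int[lebesgue_measure]_(tau in `[0, t]) complex.Im (semigroup tau u s))).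

Definition dom_funA g : set (R -> R[i]) := [set u | L1 u /\
  (\int[lebesgue_measure]_(s in `]1%R, +oo[)
     (g s^-1 * Normc.normc (u s))%:E < +oo)%E].

Lemma opAE u s : opA u s = u s / s%:C.
Proof. by rewrite /opA /funA /= -fmorphV mulrC. Qed.

Lemma semigroupE t u s : semigroup t u s = (expR (- t / s))%:C * u s.
Proof. by rewrite /semigroup /funA mulNr. Qed.

Lemma integral_expR_div (t s r : R) : 0 < t -> s != 0 ->
  \int[lebesgue_measure]_(tau in `[0, t]) (expR (- (tau * s^-1)) * r) =
  s * (1 - expR (- t / s)) * r.
Proof.
move=> t0 s0.
pose f (x : R) := expR (- (x * s^-1)) * r.
pose F (x : R) := - s * expR (- (x * s^-1)) * r.
have dF (x : R) : is_derive x 1 F (f x).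
  rewrite /F /f; apply: is_derive_eq.
  rewrite /GRing.scale /=; field.
  by rewrite s0.
have cont (h : R -> R) (dh : forall x : R, derivable h x 1) : continuous h.
  by move=> x; apply: differentiable_continuous; apply/derivable1_diffP.
have cf : continuous f.
  by apply: cont => x; rewrite /f; apply: ex_derive.
have cF : continuous F by apply: cont => x; apply: ex_derive.
rewrite /Rintegral (@continuous_FTC2 _ f F) //.
- by rewrite -EFinB /= /F mul0r oppr0 expR0 -(mulNr t); ring.
- exact: continuous_subspaceT.
- split=> [x _||]; first exact: ex_derive.
  + by apply: cvg_at_right_filter; exact: cF.
  + by apply: cvg_at_left_filter; exact: cF.
- by move=> x _; rewrite derive1E derive_val.
Qed.

Lemma cesaro_semigroupE t u s : 0 < t -> s != 0 ->
  cesaro_semigroup t u s = (s * (1 - expR (- t / s)) / t)%:C * u s.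
Proof.
move=> t0 s0; rewrite /cesaro_semigroup /semigroup /funA; case: (u s) => a b.
under eq_Rintegral => x _ do rewrite /= mul0r subr0.
under [X in _ +i* X]eq_Rintegral => x _ do rewrite /= mul0r addr0.
rewrite !integral_expR_div //; apply/eqP; rewrite eq_complex /=.
by apply/andP; split; apply/eqP; ring.
Qed.

End operators.

(* Main.v *)
(* By Tonelli, the integral equals the integral of |u(s)| W(s) over s > 1, where
   W(s) is the integral over t >= 1 of g(1/t) s (1 - e^(-t/s)) / t^2.  Since
   1 - e^(-y) is comparable to min(y, 1), W(1/x) is comparable to
   (1/x) int_0^x g + int_x^1 g(y)/y dy.  Hence the pointwise condition says
   W(s) <= C g(1/s), i.e. that the weight W is dominated by the weight defining
   dom(g(A)); if this fails, a sum of humps placed where W(s)/g(1/s) is large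
   gives a u in dom(g(A)) for which the integral diverges. *)
Require Import Defs.
From mathcomp Require Import all_boot all_order all_algebra.
From mathcomp Require Import complex.
From mathcomp Require Import all_classical all_reals all_analysis.
From mathcomp Require Import measurable_realfun.
From mathcomp Require Import ring lra.

Import Order.TTheory GRing.Theory Num.Theory.
Import numFieldNormedType.Exports.

Local Open Scope classical_set_scope.
Local Open Scope ring_scope.

(** Replacing 1 - e^(-y) by a minimum costs a factor 2 in one direction only, and it makes the
    weight both explicitly computable and visibly monotone in [s]. The weight so obtained is exactly
    the left side of the pointwise condition at x = 1/s. A single point with a large ratio
    W(s)/g(1/s) would be invisible to an integral, so the ratio must stay large on a whole interval.
    It does so on [s, 2s]: the weight is nondecreasing, and since z g(z) is nondecreasing, g(1/x) <=
    2 g(1/s) there. A hump can therefore sit on this interval, whose length s enters its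
    normalisation. No weight is known in advance to be finite. The comparison is carried out in the
    extended reals, and the integrability of [g] on (0, 1) comes out as a consequence. *)

Section kernel.
Set Implicit Arguments.
Unset Strict Implicit.
Context {R : realType}.
Implicit Types t s x y : R.

Lemma subr_expRN_ge x : 0 <= x -> x / (1 + x) <= 1 - expR (- x).
Proof.
move=> x0; have x1 : 0 < 1 + x by lra.
rewrite expRN lerBrDr -lerBrDl.
have -> : 1 - x / (1 + x) = (1 + x)^-1 by field; rewrite gt_eqF.
by rewrite lef_pV2 ?posrE ?expR_gt0// expR_ge1Dx.
Qed.

Definition cesaro_kernel t s : R := s * (1 - expR (- t / s)) / t.

(** Surrogate for [cesaro_kernel], the multiplier of C_t(A). Its two regimes meet at t = s, which is
    where the two integrals of the pointwise condition separate. *)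
Definition min_kernel t s : R := Num.min (s / t) 1.

Lemma min_kernel_ge0 t s : 0 < t -> 0 < s -> 0 <= min_kernel t s.
Proof. by move=> t0 s0; rewrite le_min ler01 divr_ge0// ltW. Qed.

Lemma cesaro_kernel_le t s : 0 < t -> 0 < s ->
  cesaro_kernel t s <= min_kernel t s.
Proof.
move=> t0 s0; rewrite /cesaro_kernel le_min; apply/andP; split.
  by rewrite ler_pM2r ?invr_gt0// -[leRHS]mulr1 ler_pM2l// lerBlDr lerDl expR_ge0.
rewrite ler_pdivrMr// mul1r -ler_pdivlMl// [_^-1 * _]mulrC.
by have := expR_ge1Dx (- t / s); rewrite mulNr; lra.
Qed.

(** With y = t/s the kernel is (1 - e^(-y))/y >= 1/(1 + y). The 2 comes from 1 + y <= 2 max(1,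
    y). *)
Lemma cesaro_kernel_ge t s : 0 < t -> 0 < s ->
  min_kernel t s <= 2 * cesaro_kernel t s.
Proof.
move=> t0 s0; set y := t / s.
have y0 : 0 < y by exact: divr_gt0.
have -> : cesaro_kernel t s = (1 - expR (- y)) / y.
  by rewrite /cesaro_kernel /y -mulNr; field; rewrite !gt_eqF.
have -> : min_kernel t s = Num.min y^-1 1 by rewrite /y invf_div.
have h := subr_expRN_ge (ltW y0).
have : (1 + y)^-1 <= (1 - expR (- y)) / y.
  by rewrite ler_pdivlMr// mulrC.
suff : Num.min y^-1 1 <= 2 * (1 + y)^-1 by lra.
rewrite mulrC ler_pdivlMl; last lra.
have [y1|y1] := leP y 1.
  rewrite min_r; first lra.
  by rewrite -invr1 lef_pV2 ?posrE.
rewrite min_l; last by rewrite -invr1 lef_pV2 ?posrE// ltW.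
rewrite mulrDl mul1r divff ?gt_eqF//.
have : y^-1 <= 1 by rewrite -invr1 lef_pV2 ?posrE// ltW.
by lra.
Qed.

Lemma cesaro_kernel_ge0 t s : 0 < t -> 0 < s -> 0 <= cesaro_kernel t s.
Proof.
move=> t0 s0; have := cesaro_kernel_ge t0 s0.
by have := min_kernel_ge0 t0 s0; lra.
Qed.

Lemma min_kernel_nondecreasing t s s' : 0 < t -> s <= s' ->
  min_kernel t s <= min_kernel t s'.
Proof.
move=> t0 ss'; rewrite /min_kernel le_min ge_min ge_min lexx orbT andbT.
by rewrite ler_pM2r ?invr_gt0// ss'.
Qed.

End kernel.

(** * Monotonicity, continuity and positivity of Stieltjes functions *)

Section decreasing_profile.
Set Implicit Arguments.
Unset Strict Implicit.
Context {R : realType}.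
Implicit Types (g f : R -> R) (x y : R).

(* All that is used of a Stieltjes function: the bounds
   g(x) <= g(y) <= (x / y) g(x) for y <= x also give its continuity. *)
Definition decreasing_profile g := [/\
  forall x, 0 < x -> 0 < g x,
  forall x y, 0 < x -> x <= y -> g y <= g x &
  forall x y, 0 < x -> x <= y -> x * g x <= y * g y].

Lemma decreasing_profile_continuous g x : decreasing_profile g -> 0 < x ->
  {for x, continuous g}.
Proof.
move=> [gp gd gi] x0; apply/cvgrPdist_le => /= e e0.
have gx := gp _ x0.
near=> y.
have yx : `|x - y| <= x / 2.
  by near: y; apply: cvgr_dist_le => //; lra.
(* The previous radius forces y >= x/2, hence g(y) <= 2 g(x) when y < x. This is the 2 in the
   denominator here. *)
have ye : `|x - y| <= e * x / (2 * g x).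
  near: y; apply: cvgr_dist_le => //.
  by rewrite !mulr_gt0// invr_gt0 mulr_gt0.
have y2 : x <= 2 * y by move: yx; rewrite ler_norml; lra.
have y0 : 0 < y by lra.
have gy := gp _ y0.
have exg : `|x - y| * (2 * g x) <= e * x by rewrite -ler_pdivlMr ?mulr_gt0.
have [xy|xy] := leP x y.
  have h1 := gd _ _ x0 xy; have h2 := gi _ _ x0 xy.
  move: exg; rewrite ler0_norm ?subr_le0// => exg.
  rewrite ger0_norm ?subr_ge0//.
  rewrite -(ler_pM2r y0); nra.
have h1 := gd _ _ y0 (ltW xy); have h2 := gi _ _ y0 (ltW xy).
move: exg; rewrite ger0_norm ?subr_ge0 ?(ltW xy)// => exg.
rewrite ler0_norm ?subr_le0//.
rewrite -(ler_pM2r x0).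
nra.
Unshelve. all: by end_near. Qed.

Lemma continuous_pos_measurable f (D : set R) : measurable D ->
  D `<=` `]0, +oo[ -> (forall x, 0 < x -> {for x, continuous f}) ->
  measurable_fun D f.
Proof.
move=> mD D0 cf; apply: (measurable_funS _ D0) => //.
apply: open_continuous_measurable_fun; first exact: interval_open.
by move=> x; rewrite inE/= in_itv/= andbT; exact: cf.
Qed.

Lemma inv_continuous_pos f x : (forall x, 0 < x -> {for x, continuous f}) ->
  0 < x -> {for x, continuous (fun x => f x^-1)}.
Proof.
move=> cf x0; apply: (@continuous_comp R R R GRing.inv f).
  by apply: inv_continuous; rewrite gt_eqF.
by apply: cf; rewrite invr_gt0.
Qed.

Lemma decreasing_profile_inv_measurable g : decreasing_profile g ->
  measurable_fun (`]1, +oo[ : set R) (fun x => g x^-1).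
Proof.
move=> gP; apply: continuous_pos_measurable => // [x/=|x x0].
  by rewrite !in_itv/= !andbT; lra.
by apply: inv_continuous_pos => // y; exact: decreasing_profile_continuous.
Qed.

(** For fixed s > 0, 1/(z + s) decreases in z while z/(z + s) increases. Both properties survive
    integration against [mu]. *)
Lemma stieltjes_decreasing_profile
    (mu : {measure set (measurableTypeR R) -> \bar R}) g :
  stieltjes mu g -> g x @[x --> 0^'+] --> +oo -> decreasing_profile g.
Proof.
move=> [_ _ gE] g0.
have mk (z : R) : 0 < z ->
    measurable_fun (`]0%R, +oo[ : set R) (fun s => ((z + s)^-1)%:E).
  move=> z0; apply/measurable_EFinP; apply: continuous_pos_measurable => //.
  move=> x x0; apply: (@continuous_comp R R R (fun s => z + s) GRing.inv).
    by apply: cvgD; [exact: cvg_cst|exact: cvg_id].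
  by apply: inv_continuous; rewrite gt_eqF// addr_gt0.
have g_ge0 z : 0 < z -> 0 <= g z.
  move=> z0; rewrite -lee_fin gE//; apply: integral_ge0 => s/=.
  by rewrite in_itv/= andbT => s0; rewrite lee_fin invr_ge0 ltW// addr_gt0.
have gd x y : 0 < x -> x <= y -> g y <= g x.
  move=> x0 xy; have y0 : 0 < y by lra.
  rewrite -lee_fin !gE//; apply: ge0_le_integral => //.
  - move=> s/=; rewrite in_itv/= andbT => s0.
    by rewrite lee_fin invr_ge0; lra.
  - exact: mk.
  - exact: mk.
  - move=> s/=; rewrite in_itv/= andbT => s0.
    by rewrite lee_fin lef_pV2 ?posrE; lra.
have gi x y : 0 < x -> x <= y -> x * g x <= y * g y.
  move=> x0 xy; have y0 : 0 < y by lra.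
  rewrite -lee_fin !EFinM !gE// -!ge0_integralZl ?lee_fin ?(ltW x0) ?(ltW y0)//.
  - apply: ge0_le_integral => //.
    + move=> s/=; rewrite in_itv/= andbT => s0.
      by rewrite -EFinM lee_fin divr_ge0; lra.
    + by apply/measurable_funeM; exact: mk.
    + by apply/measurable_funeM; exact: mk.
    + move=> s/=; rewrite in_itv/= andbT => s0; rewrite -!EFinM lee_fin.
      rewrite ler_pdivrMr ?addr_gt0// mulrAC ler_pdivlMr ?addr_gt0//.
      by rewrite !mulrDr [y * x]mulrC lerD2l ler_wpM2r// ltW.
  - exact: mk.
  - by move=> s/=; rewrite in_itv/= andbT => s0; rewrite lee_fin invr_ge0; lra.
  - exact: mk.
  - by move=> s/=; rewrite in_itv/= andbT => s0; rewrite lee_fin invr_ge0; lra.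
split => // x x0.
(* The blow-up at 0+ rules out g = 0: [g] is positive at some z < x, and z g(z) <= x g(x) carries
   this to x. *)
have [z [z0 zx gz]] : exists z, [/\ 0 < z, z < x & 0 < g z].
  have [z [[z0 zx] gz]] : exists z, (0 < z /\ z < x) /\ 1 < g z.
    have : \forall z \near 0^'+, (0 < z /\ z < x) /\ 1 < g z.
      near=> z; split; first by split; near: z;
        [exact: nbhs_right_gt|exact: nbhs_right_lt].
      by near: z; move/cvgryPgt : g0; exact.
    by move/filter_ex => [z ?]; exists z.
  by exists z; split => //; lra.
have := gi _ _ z0 (ltW zx).
have : 0 < z * g z by exact: mulr_gt0.
by move=> h1 h2; rewrite -(pmulr_rgt0 _ x0); lra.
Unshelve. all: by end_near. Qed.

End decreasing_profile.

(** * The substitution x = 1/t between (0, 1] and [1, oo) *)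

Section inversion.
Set Implicit Arguments.
Unset Strict Implicit.
Context {R : realType}.
Implicit Types (G g : R -> R) (x t s : R).
Local Notation leb := (@lebesgue_measure R).

Lemma derive1_inv x : x != 0 -> (@GRing.inv R)^`()%classic x = - x ^- 2.
Proof.
move=> x0; rewrite derive1E (@deriveV _ _ id)// derive_id.
by rewrite /GRing.scale/= mulr1.
Qed.

Lemma integral_inv_itv G (b : R) : 1 <= b ->
  (forall x, 0 < x -> {for x, continuous G}) ->
  (\int[leb]_(x in `[(b^-1)%R, 1%R]) (G x)%:E =
   \int[leb]_(t in `[1%R, b]) (G t^-1 / t ^+ 2)%:E)%E.
Proof.
move=> b1 cG; have b0 : 0 < b by lra.
have cinv x : 0 < x -> {for x, continuous (@GRing.inv R)}.
  by move=> x0; apply: inv_continuous; rewrite gt_eqF.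
have cder x : 0 < x -> {for x, continuous (@GRing.inv R)^`()%classic}.
  move=> x0; have c2 : {for x, continuous (fun y : R => - (y ^- 2))}.
    apply: cvgN; apply: cvgV; first by rewrite gt_eqF// exprn_gt0.
    exact: exprn_continuous.
  change ((@GRing.inv R)^`()%classic y @[y --> x] --> (@GRing.inv R)^`()%classic x).
  rewrite (derive1_inv (lt0r_neq0 x0)).
  apply: cvg_trans c2; apply: near_eq_cvg; near=> y.
  by rewrite derive1_inv// gt_eqF//; near: y; exact: lt_nbhsr.
have := @integration_by_substitution_decreasing R GRing.inv G 1 b b1.
rewrite invr1 => ->//.
- apply: eq_integral => t; rewrite inE/= in_itv/= => /andP[t1 _].
  by rewrite !fctE derive1_inv ?opprK// gt_eqF//; lra.
- move=> x y; rewrite !in_itv/= => /andP[x1 _] /andP[y1 _] yx.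
  by rewrite ltf_pV2 ?posrE//; lra.
- by move=> x; rewrite in_itv/= => /andP[x1 _]; apply: cder; lra.
- apply/cvg_ex; exists ((@GRing.inv R)^`()%classic 1).
  by apply: cvg_at_right_filter; apply: cder.
- apply/cvg_ex; exists ((@GRing.inv R)^`()%classic b).
  by apply: cvg_at_left_filter; apply: cder.
- split.
  + move=> x; rewrite in_itv/= => /andP[x1 _].
    by apply: derivableV => //; rewrite gt_eqF//; lra.
  + by apply: cvg_at_right_filter; apply: cinv.
  + by apply: cvg_at_left_filter; apply: cinv.
- apply: continuous_in_subspaceT => x; rewrite inE/= in_itv/= => /andP[bx _].
  by apply: cG; apply: lt_le_trans bx; rewrite invr_gt0.
Unshelve. all: by end_near. Qed.

(** Inversion exchanges the exhaustions [1/(n+1), 1] and [1, n+1], so by monotone convergence both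
    sides are limits of the same sequence [I]. Both may be infinite. *)
Lemma integral_inv G :
  (forall x, 0 < x -> {for x, continuous G}) ->
  (forall x, 0 < x -> 0 <= G x) ->
  (\int[leb]_(x in `]0%R, 1%R]) (G x)%:E =
   \int[leb]_(t in `[1%R, +oo[) (G t^-1 / t ^+ 2)%:E)%E.
Proof.
move=> cG G0.
have U1 : `]0, 1]%classic = \bigcup_n `[(n.+1%:R : R)^-1, 1]%classic.
  apply/seteqP; split => x/=.
    rewrite in_itv/= => /andP[x0 x1]; exists (Num.truncn x^-1) => //=.
    rewrite in_itv/= x1 andbT -[leRHS]invrK lef_pV2 ?posrE ?invr_gt0//.
    exact/ltW/truncnS_gt.
  move=> [n _]/=; rewrite !in_itv/= => /andP[nx ->]; rewrite andbT.
  by apply: lt_le_trans nx; rewrite invr_gt0.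
have U2 : `[1, +oo[%classic = \bigcup_n `[1, (n.+1%:R : R)]%classic.
  apply/seteqP; split => x/=.
    rewrite in_itv/= andbT => x1; exists (Num.truncn x) => //=.
    by rewrite in_itv/= x1/= ltW// truncnS_gt.
  by move=> [n _]/=; rewrite !in_itv/= andbT => /andP[].
rewrite U1 U2.
pose I n := (\int[leb]_(x in `[((n.+1%:R : R)^-1)%R, 1%R]) (G x)%:E)%E.
apply: (@cvg_unique _ (@ereal_hausdorff R) (I @ \oo)).
  apply: ge0_nondecreasing_set_cvg_integral => //.
  - move=> m n mn; apply/subsetPset => x/=; rewrite !in_itv/= => /andP[mx ->].
    by rewrite andbT (le_trans _ mx)// lef_pV2 ?posrE// ler_nat ltnS.
  - move=> n; apply/measurable_EFinP; apply: continuous_pos_measurable => //.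
    move=> x/=; rewrite !in_itv/= andbT => /andP[nx _].
    by apply: lt_le_trans nx; rewrite invr_gt0.
  - move=> n x/=; rewrite !in_itv/= => /andP[nx _]; rewrite lee_fin G0//.
    by apply: lt_le_trans nx; rewrite invr_gt0.
have -> : I = fun n => (\int[leb]_(t in `[1%R, n.+1%:R]) (G t^-1 / t ^+ 2)%:E)%E.
  by apply/funext => n; rewrite /I integral_inv_itv ?ler1n.
apply: ge0_nondecreasing_set_cvg_integral => //.
- move=> m n mn; apply/subsetPset => x/=; rewrite !in_itv/= => /andP[-> mx].
  by rewrite (le_trans mx)// ler_nat ltnS.
- move=> n; apply/measurable_EFinP; apply: continuous_pos_measurable => //.
    by move=> x/=; rewrite !in_itv/= andbT => /andP[x1 _]; lra.
  move=> x x0; apply: cvgM; first exact: inv_continuous_pos.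
  apply: cvgV; first by rewrite gt_eqF// exprn_gt0.
  exact: exprn_continuous.
- move=> n x/=; rewrite !in_itv/= => /andP[x1 _]; rewrite lee_fin.
  by rewrite divr_ge0// ?exprn_ge0 ?G0 ?invr_gt0//; lra.
Qed.

End inversion.

(** * Tonelli's theorem on a measurable rectangle *)

Section tonelli.
Set Implicit Arguments.
Unset Strict Implicit.
Local Open Scope ereal_scope.
Context d1 d2 (T1 : measurableType d1) (T2 : measurableType d2) (R : realType).
Context (m1 : {sigma_finite_measure set T1 -> \bar R}).
Context (m2 : {sigma_finite_measure set T2 -> \bar R}).
Context (A : set T1) (B : set T2) (f : T1 * T2 -> \bar R).
Context (mA : measurable A) (mB : measurable B).
Context (mf : measurable_fun (A `*` B) f).
Context (f0 : forall x y, A x -> B y -> 0 <= f (x, y)).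

(** Extension by zero off the rectangle turns the iterated integrals over [A] and [B] into integrals
    over the whole spaces. *)
Let fAB := f \_ (A `*` B).

Let mfAB : measurable_fun setT fAB.
Proof. exact/(measurable_restrictT f (measurableX mA mB)). Qed.

Let fAB0 z : 0 <= fAB z.
Proof. by apply: erestrict_ge0 => -[x y] -[/= Ax By]; exact: f0. Qed.

Let int1 y : B y -> \int[m1]_x fAB (x, y) = \int[m1]_(x in A) f (x, y).
Proof.
move=> By; rewrite [RHS]integral_mkcond; apply: eq_integral => x _.
by rewrite /fAB !patchE in_setX/= (mem_set By) andbT.
Qed.

Let int1N y : ~ B y -> \int[m1]_x fAB (x, y) = 0.
Proof.
move=> By; apply: integral0_eq => x _.
by rewrite /fAB patchE in_setX/= (memNset By) andbF.
Qed.

Lemma tonelli_on : \int[m1]_(x in A) \int[m2]_(y in B) f (x, y) =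
  \int[m2]_(y in B) \int[m1]_(x in A) f (x, y).
Proof.
transitivity (\int[m1]_x \int[m2]_y fAB (x, y)).
  rewrite integral_mkcond; apply: eq_integral => x _.
  rewrite patchE; case: ifPn => Ax.
    rewrite integral_mkcond; apply: eq_integral => y _.
    by rewrite /fAB !patchE in_setX/= Ax.
  rewrite integral0_eq// => y _.
  by rewrite /fAB patchE in_setX/= (negbTE Ax).
rewrite fubini_tonelli// [RHS]integral_mkcond; apply: eq_integral => y _.
rewrite patchE; case: ifPn => By; first by rewrite int1//; exact: set_mem.
by rewrite int1N// => /mem_set; apply/negP.
Qed.

Lemma measurable_integral_section :
  measurable_fun B (fun y => \int[m1]_(x in A) f (x, y)).
Proof.
have := measurable_fun_fubini_tonelli_G (m1 := m1) _ mfAB fAB0.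
move=> /(measurable_funS measurableT (@subsetT _ B)).
by apply: eq_measurable_fun => y /set_mem By; rewrite /fubini_G int1.
Qed.

Lemma measurable_section_l y : B y -> measurable_fun A (fun x => f (x, y)).
Proof.
move=> By.
apply: (measurable_comp (F := A `*` B) (f := f) (g := fun x => (x, y))) => //.
- exact: measurableX.
- by move=> _ [x Ax <-].
- exact: measurable_funTS (pair2_measurable y).
Qed.

Lemma measurable_section_r x : A x -> measurable_fun B (fun y => f (x, y)).
Proof.
move=> Ax.
apply: (measurable_comp (F := A `*` B) (f := f) (g := fun y => (x, y))) => //.
- exact: measurableX.
- by move=> _ [y By <-].
- exact: measurable_funTS (pair1_measurable x).
Qed.

End tonelli.

Section kernel_measurability.
Set Implicit Arguments.
Unset Strict Implicit.
Context {R : realType}.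

Lemma cesaro_kernel_measurable :
  measurable_fun (`[1, +oo[ `*` `]1, +oo[ : set (R * R))
    (fun p => cesaro_kernel p.1 p.2).
Proof.
have m1 : measurable_fun (`[1, +oo[ `*` `]1, +oo[ : set (R * R)) fst.
  exact: measurable_funTS.
have m2 : measurable_fun (`[1, +oo[ `*` `]1, +oo[ : set (R * R)) snd.
  exact: measurable_funTS.
have mV : measurable_fun (`[1, +oo[ : set R) (@GRing.inv R).
  apply: continuous_pos_measurable => // [x/=|x x0].
    by rewrite !in_itv/= !andbT; lra.
  by apply: inv_continuous; rewrite gt_eqF.
have mV1 : measurable_fun (`[1, +oo[ `*` `]1, +oo[ : set (R * R))
    (@GRing.inv R \o fst).
  have /(_ (measurable_itv _)) k := measurable_comp _ _ mV m1; apply: k.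
  by move=> _ [[x y] [/= x1 _] <-].
have mV2 : measurable_fun (`[1, +oo[ `*` `]1, +oo[ : set (R * R))
    (@GRing.inv R \o snd).
  have /(_ (measurable_itv _)) k := measurable_comp _ _ mV m2; apply: k.
  move=> _ [[x y] [/= _ y1] <-] /=; move: y1.
  by rewrite !in_itv/= !andbT => /ltW.
apply: measurable_funM => //; apply: measurable_funM => //.
apply: measurable_funB => //; apply: measurableT_comp => //.
by apply: measurable_funM => //; exact: measurableT_comp.
Qed.

End kernel_measurability.

(** * Comparison and evaluation of the two weights *)

Section weights.
Set Implicit Arguments.
Unset Strict Implicit.
Context {R : realType} (g : R -> R) (gP : decreasing_profile g).
Implicit Types (v : R -> R) (k : R -> R -> R) (s t x : R) (u : R -> R[i]).
Local Notation leb := (@lebesgue_measure R).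

(** The kernel is a parameter because two weights are compared: the one with [cesaro_kernel] arises
    from Tonelli, the one with [min_kernel] can be computed. Near 0 [g] may fail to be integrable,
    so the value is an extended real. *)
Definition weight k s : \bar R :=
  (\int[leb]_(t in `[1%R, +oo[) (g t^-1 / t * k t s)%:E)%E.

Let g_gt0 x : 0 < x -> 0 < g x. Proof. by case: gP => + _ _; exact. Qed.

Let gV_ge0 t : 0 < t -> 0 <= g t^-1 / t.
Proof. by move=> t0; rewrite divr_ge0 ?ltW// g_gt0 ?invr_gt0. Qed.

Lemma weight_integrand_ge0 t s : 0 < t -> 0 < s ->
  0 <= g t^-1 / t * cesaro_kernel t s.
Proof. by move=> t0 s0; rewrite mulr_ge0 ?gV_ge0 ?cesaro_kernel_ge0. Qed.

Let gV_continuous t : 0 < t -> {for t, continuous (fun t => g t^-1 / t)}.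
Proof.
move=> t0; apply: cvgM; last by apply: inv_continuous; rewrite gt_eqF.
by apply: inv_continuous_pos => // x; exact: decreasing_profile_continuous.
Qed.

Let gV_measurable : measurable_fun (`[1, +oo[ : set R) (fun t => g t^-1 / t).
Proof.
apply: continuous_pos_measurable gV_continuous => // x/=.
by rewrite !in_itv/= !andbT; lra.
Qed.

(** Taken with v = |u| for the exchange of integrals, and with v = 1 for the measurability of the
    weight itself. *)
Lemma cesaro_integrand_measurable v :
  measurable_fun (`]1, +oo[ : set R) v ->
  measurable_fun (`[1, +oo[ `*` `]1, +oo[ : set (R * R))
    (fun p => (g p.1^-1 / p.1 * cesaro_kernel p.1 p.2 * v p.2)%:E).
Proof.
move=> mv; apply/measurable_EFinP.
have m1 : measurable_fun (`[1, +oo[ `*` `]1, +oo[ : set (R * R)) fst.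
  exact: measurable_funTS.
have m2 : measurable_fun (`[1, +oo[ `*` `]1, +oo[ : set (R * R)) snd.
  exact: measurable_funTS.
apply: measurable_funM; first apply: measurable_funM.
- have /(_ (measurable_itv _)) h := measurable_comp _ _ gV_measurable m1.
  by apply: h => _ [[x y] [/= x1 _] <-].
- exact: cesaro_kernel_measurable.
- have /(_ (measurable_itv _)) h := measurable_comp _ _ mv m2.
  by apply: h => _ [[x y] [/= _ y1] <-].
Qed.

Let cesaro_integrand_ge0 v :
  (forall s, 1 < s -> 0 <= v s) ->
  forall t s, `[1, +oo[%classic t -> `]1, +oo[%classic s ->
    (0 <= (g t^-1 / t * cesaro_kernel t s * v s)%:E)%E.
Proof.
move=> v0 t s/=; rewrite !in_itv/= !andbT => t1 s1; rewrite lee_fin.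
by rewrite mulr_ge0 ?v0// weight_integrand_ge0//; lra.
Qed.

Lemma weight_cesaro_section_measurable s : 1 < s ->
  measurable_fun (`[1, +oo[ : set R)
    (fun t => (g t^-1 / t * cesaro_kernel t s)%:E).
Proof.
move=> s1.
have := measurable_section_l (measurable_itv _) (measurable_itv _)
  (@cesaro_integrand_measurable (fun=> 1) (@measurable_cst _ _ _ _ _ _)) (y := s).
rewrite /= in_itv/= s1 => /(_ isT).
by apply: eq_measurable_fun => t _ /=; rewrite mulr1.
Qed.

Lemma weight_cesaro_measurable :
  measurable_fun (`]1, +oo[ : set R) (weight cesaro_kernel).
Proof.
have := measurable_integral_section leb (measurable_itv _) (measurable_itv _)
  (@cesaro_integrand_measurable (fun=> 1) (@measurable_cst _ _ _ _ _ _))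
  (cesaro_integrand_ge0 (fun _ _ => ler01)).
apply: eq_measurable_fun => s _; apply: eq_integral => t _ /=.
by rewrite mulr1.
Qed.

Lemma weight_min_section_measurable s :
  measurable_fun (`[1, +oo[ : set R)
    (fun t => (g t^-1 / t * min_kernel t s)%:E).
Proof.
apply/measurable_EFinP; apply: measurable_funM => //.
apply: measurable_minr => //; apply: measurable_funM => //.
apply: continuous_pos_measurable => // [x/=|x x0].
  by rewrite !in_itv/= !andbT; lra.
by apply: inv_continuous; rewrite gt_eqF.
Qed.

Lemma weight_cesaro_ge0 s : 1 < s -> (0 <= weight cesaro_kernel s)%E.
Proof.
move=> s1; apply: integral_ge0 => t/=; rewrite in_itv/= andbT => t1.
by rewrite lee_fin weight_integrand_ge0//; lra.
Qed.

Lemma weight_cesaro_le s : 1 < s ->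
  (weight cesaro_kernel s <= weight min_kernel s)%E.
Proof.
move=> s1; apply: ge0_le_integral => //.
- move=> t/=; rewrite in_itv/= andbT => t1.
  by rewrite lee_fin weight_integrand_ge0//; lra.
- exact: weight_cesaro_section_measurable.
- exact: weight_min_section_measurable.
- move=> t/=; rewrite in_itv/= andbT => t1.
  by rewrite lee_fin ler_wpM2l ?gV_ge0 ?cesaro_kernel_le//; lra.
Qed.

Lemma weight_cesaro_ge s : 1 < s ->
  (weight min_kernel s <= 2%:E * weight cesaro_kernel s)%E.
Proof.
move=> s1; rewrite /weight -ge0_integralZl ?lee_fin//; first last.
- move=> t/=; rewrite in_itv/= andbT => t1.
  by rewrite lee_fin weight_integrand_ge0//; lra.
- exact: weight_cesaro_section_measurable.
apply: ge0_le_integral => //.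
- move=> t/=; rewrite in_itv/= andbT => t1.
  by rewrite lee_fin mulr_ge0 ?gV_ge0 ?min_kernel_ge0//; lra.
- exact: weight_min_section_measurable.
- by apply: measurable_funeM; exact: weight_cesaro_section_measurable.
- move=> t/=; rewrite in_itv/= andbT => t1.
  by rewrite -EFinM lee_fin mulrCA ler_wpM2l ?gV_ge0 ?cesaro_kernel_ge//; lra.
Qed.

Lemma weight_min_nondecreasing s s' : 0 < s -> s <= s' ->
  (weight min_kernel s <= weight min_kernel s')%E.
Proof.
move=> s0 ss'; apply: ge0_le_integral => //.
- move=> t/=; rewrite in_itv/= andbT => t1.
  by rewrite lee_fin mulr_ge0 ?gV_ge0 ?min_kernel_ge0//; lra.
- exact: weight_min_section_measurable.
- exact: weight_min_section_measurable.
- move=> t/=; rewrite in_itv/= andbT => t1.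
  by rewrite lee_fin ler_wpM2l ?gV_ge0 ?min_kernel_nondecreasing//; lra.
Qed.

(* The substitution y = 1/t turns min(s/t, 1) dt/t into min(s, 1/y) dy. *)
Lemma weight_minE x : 0 < x -> x < 1 ->
  weight min_kernel x^-1 =
  ((x^-1)%:E * (\int[leb]_(y in `]0%R, x[) (g y)%:E) +
   \int[leb]_(y in `]x, 1%R[) (g y / y)%:E)%E.
Proof.
move=> x0 x1.
pose G y := g y * Num.min x^-1 y^-1.
have cG y : 0 < y -> {for y, continuous G}.
  move=> y0; apply: cvgM; first exact: decreasing_profile_continuous.
  apply: (@continuous_min _ _ (cst x^-1) (@GRing.inv R)); first exact: cvg_cst.
  by apply: inv_continuous; rewrite gt_eqF.
have G0 y : 0 < y -> 0 <= G y.
  by move=> y0; rewrite mulr_ge0 ?ltW ?g_gt0// lt_min !invr_gt0 x0.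
have mG (D : set R) : measurable D -> D `<=` `]0, +oo[ ->
    measurable_fun D (EFin \o G).
  by move=> mD D0; apply/measurable_EFinP; exact: continuous_pos_measurable.
transitivity (\int[leb]_(y in `]0%R, 1%R]) (G y)%:E)%E.
  rewrite (integral_inv cG G0); apply: eq_integral => t.
  rewrite inE/= in_itv/= andbT => t1; congr EFin.
  have t0 : 0 < t by lra.
  (* Writing 1 as t/t pulls 1/t out of the minimum, which supplies the second factor 1/t of the
     substitution. *)
  rewrite /G /min_kernel invrK expr2 -[1 in LHS](divff (lt0r_neq0 t0)).
  rewrite -minr_pMl ?invr_ge0 ?ltW//.
  by field; rewrite gt_eqF.
(* The minimum of 1/x and 1/y switches at y = x. The closed right endpoints are then dropped as null
   sets. *)
rewrite (_ : `]0, 1]%classic = `]0, x]%classic `|` `]x, 1]%classic); last first.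
  by rewrite -itv_bndbnd_setU// bnd_simp ltW.
rewrite ge0_integral_setU//; last 3 first.
- apply: mG; first exact: measurableU.
  by move=> y/= []; rewrite !in_itv/=; lra.
- by move=> y/= [|]; rewrite !in_itv/= => ?; rewrite lee_fin G0//; lra.
- apply/disj_setPS => y/= []; rewrite !in_itv/= => /andP[_ yx] /andP[xy _].
  by move: (lt_le_trans xy yx); rewrite ltxx.
congr (_ + _)%E.
- rewrite -integral_itv_bndo_bndc.
    rewrite -ge0_integralZl//.
    + apply: eq_integral => y; rewrite inE/= in_itv/= => /andP[y0 yx].
      rewrite /G min_l; first by rewrite -EFinM mulrC.
      by rewrite lef_pV2 ?posrE// ltW.
    + apply/measurable_EFinP; apply: continuous_pos_measurable => //.
        by move=> y/=; rewrite !in_itv/= andbT => /andP[].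
      by move=> y; exact: decreasing_profile_continuous.
    + by move=> y/=; rewrite in_itv/= => /andP[y0 _]; rewrite lee_fin ltW ?g_gt0.
    + by rewrite lee_fin invr_ge0 ltW.
  by apply: mG => // y/=; rewrite !in_itv/= andbT => /andP[].
- rewrite -integral_itv_bndo_bndc.
    apply: eq_integral => y; rewrite inE/= in_itv/= => /andP[xy y1].
    have y0 : 0 < y by exact: lt_trans xy.
    by rewrite /G min_r// lef_pV2 ?posrE// ltW.
  by apply: mG => // y/=; rewrite !in_itv/= andbT => /andP[]; lra.
Qed.

End weights.

(** * The norm of the Cesaro means and the exchange of integrals *)

Section complex_norm.
Set Implicit Arguments.
Unset Strict Implicit.
Context {R : realType}.
Implicit Types (u : R -> R[i]) (s t : R).
Local Notation leb := (@lebesgue_measure R).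

Lemma normc_real (x : R) : Normc.normc (x%:C)%C = `|x|.
Proof. by rewrite /Normc.normc /= expr0n/= addr0 sqrtr_sqr. Qed.

Lemma normc_ge0 (z : R[i]) : 0 <= Normc.normc z.
Proof. by case: z => a b; exact: sqrtr_ge0. Qed.

Lemma normc_measurable (D : set R) u :
  measurable_fun D (fun s => complex.Re (u s)) ->
  measurable_fun D (fun s => complex.Im (u s)) ->
  measurable_fun D (fun s => Normc.normc (u s)).
Proof.
move=> mRe mIm.
have -> : (fun s => Normc.normc (u s)) =
    (Num.sqrt \o (fun s => complex.Re (u s) ^+ 2 + complex.Im (u s) ^+ 2)).
  by apply/funext => s /=; case: (u s).
apply: measurableT_comp.
  by apply: continuous_measurable_fun; exact: sqrt_continuous.
by apply: measurable_funD; exact: measurable_funX.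
Qed.

Lemma L1norm_cesaroE u t : 0 < t ->
  L1norm (cesaro_semigroup t u) =
  (\int[leb]_(s in `]1%R, +oo[)
    (cesaro_kernel t s * Normc.normc (u s))%:E)%E.
Proof.
move=> t0; rewrite /L1norm; apply: eq_integral => s Ds.
have s0 : 0 < s by move: Ds; rewrite inE/= in_itv/= andbT; lra.
rewrite (cesaro_semigroupE u t0) ?gt_eqF// Normc.normcM normc_real ger0_norm//.
exact: cesaro_kernel_ge0.
Qed.

End complex_norm.

Section cesaro_integral.
Set Implicit Arguments.
Unset Strict Implicit.
Context {R : realType} (g : R -> R) (gP : decreasing_profile g).
Implicit Types (u : R -> R[i]) (s t : R).
Local Notation leb := (@lebesgue_measure R).

(** All integrands are nonnegative, so the identity holds in [0, oo] without any finiteness. It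
    serves to prove divergence as well as convergence. *)
Lemma cesaro_integralE u :
  measurable_fun (`]1, +oo[ : set R) (fun s => Normc.normc (u s)) ->
  (\int[leb]_(t in `[1%R, +oo[)
    ((g t^-1)%:E * L1norm (cesaro_semigroup t u) * (t^-1)%:E) =
   \int[leb]_(s in `]1%R, +oo[)
    (weight g cesaro_kernel s * (Normc.normc (u s))%:E))%E.
Proof.
move=> mu.
have [gp _ _] := gP.
have mk := cesaro_integrand_measurable gP mu.
have k0 t s : `[1, +oo[%classic t -> `]1, +oo[%classic s ->
    (0 <= (g t^-1 / t * cesaro_kernel t s * Normc.normc (u s))%:E)%E.
  rewrite /= !in_itv/= !andbT => t1 s1; rewrite lee_fin.
  by rewrite mulr_ge0 ?normc_ge0// weight_integrand_ge0//; lra.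
have := tonelli_on leb leb (measurable_itv _) (measurable_itv _) mk k0.
rewrite /= => h.
transitivity (\int[leb]_(t in `[1%R, +oo[) \int[leb]_(s in `]1%R, +oo[)
    (g t^-1 / t * cesaro_kernel t s * Normc.normc (u s))%:E)%E.
  apply: eq_integral => t; rewrite inE/= in_itv/= andbT => t1.
  have t0 : 0 < t by lra.
  rewrite L1norm_cesaroE// muleAC -EFinM -ge0_integralZl//.
  - by apply: eq_integral => s _; rewrite -EFinM mulrA.
  - apply/measurable_EFinP; apply: measurable_funM => //.
    apply/measurable_EFinP.
    have /measurable_EFinP mc := @cesaro_kernel_measurable R.
    apply: (measurable_section_r (measurable_itv _) (measurable_itv _) mc).
    by rewrite /= in_itv/= t1.
  - move=> s/=; rewrite in_itv/= andbT => s1.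
    by rewrite lee_fin mulr_ge0 ?normc_ge0 ?cesaro_kernel_ge0//; lra.
  - by rewrite lee_fin divr_ge0 ?ltW ?gp ?invr_gt0.
rewrite h; apply: eq_integral => s; rewrite inE/= in_itv/= andbT => s1.
rewrite /weight -ge0_integralZr ?lee_fin ?normc_ge0//.
- exact: weight_cesaro_section_measurable.
- move=> t/=; rewrite in_itv/= andbT => t1.
  by rewrite lee_fin weight_integrand_ge0//; lra.
Qed.

End cesaro_integral.

(** * Summing a sequence of humps *)

Section majorant.
Set Implicit Arguments.
Unset Strict Implicit.
Local Open Scope ereal_scope.

(** The majorant is the sum of the [f n]. The pointwise bounds add up to [c1], which makes it finite
    everywhere on [D], and the weighted integrals add up to [c2]. *)
Lemma summable_majorant d (T : measurableType d) (R : realType)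
    (m : {measure set T -> \bar R}) (D : set T) (w : T -> R) (f : nat -> T -> R)
    (c1 c2 : R) :
  measurable D -> (0 <= c1)%R -> (0 <= c2)%R ->
  measurable_fun D w -> (forall x, D x -> 0 <= w x)%R ->
  (forall n, measurable_fun D (f n)) ->
  (forall n x, D x -> 0 <= f n x <= c1 / (2 ^ n.+1)%:R)%R ->
  (forall n, \int[m]_(x in D) (w x * f n x)%:E <= (c2 / (2 ^ n.+1)%:R)%:E) ->
  exists v : T -> R, [/\ measurable_fun D v,
    (forall n x, D x -> f n x <= v x)%R &
    \int[m]_(x in D) (w x * v x)%:E <= c2%:E].
Proof.
move=> mD c10 c20 mw w0 mf f0 wf.
pose V x := \sum_(n <oo) (f n x)%:E.
have fE0 n x : D x -> 0 <= (f n x)%:E.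
  by move=> Dx; rewrite lee_fin; have /andP[] := f0 n x Dx.
have Vfin x : D x -> V x \is a fin_num.
  move=> Dx; rewrite ge0_fin_numE; last by apply: nneseries_ge0 => n _ _; exact: fE0.
  apply: (@le_lt_trans _ _ c1%:E); last exact: ltry.
  apply: le_trans (epsilon_trick0 xpredT c10).
  apply: lee_nneseries => n _; first by rewrite lee_fin; have /andP[] := f0 n x Dx.
  by rewrite lee_fin; have /andP[] := f0 n x Dx.
(* [fine] would send an infinite sum to 0, but [V] is finite on [D], so nothing is lost there. *)
exists (fine \o V); split.
- apply/measurable_EFinP.
  apply: (eq_measurable_fun V) => [x /set_mem Dx|]; first by rewrite /= fineK ?Vfin.
  have := @ge0_emeasurable_sum _ _ _ D (fun n x => (f n x)%:E) xpredT.
  by apply => [n x Dx _|n _]; [exact: fE0|exact/measurable_EFinP].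
- move=> n x Dx; rewrite -lee_fin /= fineK ?Vfin//.
  (* The partial sum with n+1 terms is the first one containing [f n]. *)
  apply: le_trans (nneseries_lim_ge n.+1 _) => [|k _ _]; last exact: fE0.
  rewrite big_nat_recr//= leeDr//.
  by apply: sume_ge0 => k _; exact: fE0.
- have -> : \int[m]_(x in D) (w x * (fine \o V) x)%:E =
      \int[m]_(x in D) \sum_(n <oo) (w x * f n x)%:E.
    apply: eq_integral => x /set_mem Dx.
    rewrite EFinM /= fineK ?Vfin// /V -nneseriesZl//; last first.
      by move=> n _; exact: fE0.
  rewrite integral_nneseries//.
  + apply: le_trans (epsilon_trick0 xpredT c20); apply: lee_nneseries => n * //.
    by apply: integral_ge0 => x Dx; rewrite EFinM mule_ge0 ?fE0// lee_fin w0.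
  + by move=> n; apply/measurable_EFinP; exact: measurable_funM.
  + by move=> n x Dx; rewrite EFinM mule_ge0 ?fE0// lee_fin w0.
Qed.

End majorant.

(** * From convergence for every u to the pointwise bound on the weight *)

Section boundedness.
Set Implicit Arguments.
Unset Strict Implicit.
Context {R : realType} (g : R -> R) (gP : decreasing_profile g).
Implicit Types (u : R -> R[i]) (s t c : R).
Local Notation leb := (@lebesgue_measure R).

Lemma integral_indic_itv c s : 0 <= c -> 1 < s ->
  (\int[leb]_(x in `]1%R, +oo[) (c * (\1_(`[s, 2 * s]%classic : set R) x : R))%:E =
   (c * s)%:E)%E.
Proof.
move=> c0 s1.
have mI : measurable_fun (`]1%R, +oo[ : set R)
    (EFin \o (\1_(`[s, 2 * s]%classic : set R) : R -> R)).
  by apply/measurable_EFinP; exact: measurable_indic.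
transitivity (c%:E * \int[leb]_(x in `]1%R, +oo[)
    (\1_(`[s, 2 * s]%classic : set R) x : R)%:E)%E.
  by rewrite -ge0_integralZl.
rewrite integral_indic// setIidl; last first.
  by move=> x/=; rewrite !in_itv/= andbT => /andP[sx _]; lra.
rewrite [X in (_ * X)%E](_ : _ = s%:E) ?EFinM//.
rewrite [LHS]lebesgue_measure_itv/= lte_fin ifT; last lra.
by rewrite -EFinB; congr EFin; ring.
Qed.

Lemma weight_bounded :
  (forall u, dom_funA g u ->
    (\int[leb]_(t in `[1%R, +oo[)
      ((g t^-1)%:E * L1norm (cesaro_semigroup t u) * (t^-1)%:E) < +oo)%E) ->
  exists2 c, 0 < c & forall s, 1 < s ->
    (weight g min_kernel s <= (c * g s^-1)%:E)%E.
Proof.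
move=> H; have [gp gd gi] := gP.
have [//|nH] := pselect (exists2 c, 0 < c & forall s, 1 < s ->
    (weight g min_kernel s <= (c * g s^-1)%:E)%E).
exfalso.
(* The factor 2 pays for the passage from [min_kernel] to [cesaro_kernel], 2^(n+1) for the
   normalisation of the hump, and n+1 is what remains as lower bound. *)
have {nH} hump (n : nat) : exists s, 1 < s /\
    ((2 * (2 ^ n.+1)%:R * n.+1%:R * g s^-1)%:E < weight g min_kernel s)%E.
  apply: contrapT => nE; apply: nH.
  exists (2 * (2 ^ n.+1)%:R * n.+1%:R); first by rewrite !mulr_gt0// ltr0n expn_gt0.
  move=> s s1; rewrite leNgt; apply/negP => h; apply: nE; by exists s.
have {hump} [s /all_and2[s1 sW]] := choice hump.
have s0 n : 0 < s n by have := s1 n; lra.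
have gs n : 0 < g (s n)^-1 by rewrite gp ?invr_gt0.
(* This uniform lower bound is used twice: it makes the hump heights summable, and it makes the
   domain weight control the L_1 norm. *)
have g1 x : 1 < x -> g 1 <= g x^-1.
  move=> x1; apply: gd; first by rewrite invr_gt0; lra.
  by rewrite invf_le1; lra.
have p2 n : 0 < (2 ^ n.+1)%:R :> R by rewrite ltr0n expn_gt0.
(* The hump a_n 1_[s_n, 2 s_n] contributes at most 2^-n to the norm of g(A)u,
   because g(1/(2 s)) <= 2 g(1/s), but at least n + 1 to the integral. *)
pose a n : R := ((2 ^ n.+1)%:R * g (s n)^-1 * s n)^-1.
have a0 n : 0 < a n by rewrite invr_gt0 !mulr_gt0.
pose f n x := a n * \1_(`[s n, 2 * s n]%classic : set R) x.
have mgV := decreasing_profile_inv_measurable gP.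
have mf n : measurable_fun (`]1, +oo[ : set R) (f n).
  by apply: measurable_funM => //; exact: measurable_indic.
(* The constant 1/g(1) comes from g(1/s_n) >= g(1) and s_n > 1. The constant 2 is the growth allowed
   to g(1/x) on [s_n, 2 s_n]. *)
have [|||||v [mv fv wv]] := @summable_majorant _ _ R leb `]1, +oo[%classic
    (fun x => g x^-1) f (g 1)^-1 2 (measurable_itv _) _ _ mgV _ mf.
- by rewrite invr_ge0 ltW// gp.
- by [].
- by move=> x/=; rewrite in_itv/= andbT => x1; rewrite ltW// gp// invr_gt0; lra.
- move=> n x/= _; rewrite /f; apply/andP; split.
    by rewrite mulr_ge0// ltW.
  rewrite indicE; apply: (@le_trans _ _ (a n)).
    by rewrite ler_piMr ?(ltW (a0 _))//; case: (x \in _).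
  have h1 : 0 < g 1 by exact: gp.
  have h2 : 0 < (2 ^ n.+1)%:R * g (s n)^-1 * s n by rewrite !mulr_gt0.
  have h3 : 0 < g 1 * (2 ^ n.+1)%:R by exact: mulr_gt0.
  rewrite /a -invfM lef_pV2 ?posrE// [leLHS]mulrC -mulrA ler_pM2l//.
  by rewrite -[leLHS]mulr1 ler_pM ?g1 ?(ltW (s1 n)) ?(ltW h1).
- move=> n.
  apply: (@le_trans _ _ (\int[leb]_(x in `]1%R, +oo[)
     (2 * g (s n)^-1 * a n * \1_(`[s n, 2 * s n]%classic : set R) x)%:E)%E).
    apply: ge0_le_integral => //.
    + move=> x/=; rewrite in_itv/= andbT => x1; rewrite lee_fin.
      by rewrite mulr_ge0// ?mulr_ge0// ltW// gp// invr_gt0; lra.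
    + by apply/measurable_EFinP; exact: measurable_funM mgV (mf n).
    + by apply/measurable_EFinP; exact: measurable_funM.
    + move=> x _; rewrite lee_fin /f mulrA.
      have [xI|xI] := pselect (`[s n, 2 * s n]%classic x); last first.
        by rewrite indicE memNset// !mulr0.
      rewrite ler_wpM2r// ler_wpM2r ?(ltW (a0 n))//.
      move: xI; rewrite /= in_itv/= => /andP[sx xs].
      have x0 : 0 < x by exact: lt_le_trans sx.
      have xV : x^-1 <= (s n)^-1 by rewrite lef_pV2 ?posrE.
      have xV0 : 0 < x^-1 by rewrite invr_gt0.
      (* Monotonicity of z g(z) gives g(1/x) <= (x/s_n) g(1/s_n), and x/s_n <= 2 on the hump. *)
      have := gi _ _ xV0 xV; rewrite ler_pdivrMl// => /le_trans; apply.
      by rewrite mulrA ler_wpM2r ?(ltW (gs n))// ler_pdivrMr.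
  rewrite integral_indic_itv//; last by rewrite !mulr_ge0// ltW.
  rewrite lee_fin /a le_eqVlt; apply/orP; left; apply/eqP; field.
  by rewrite !gt_eqF.
have v0 x : 1 < x -> 0 <= v x.
  move=> x1; apply: le_trans (fv 0%N x _); last by rewrite /= in_itv/= x1.
  by rewrite mulr_ge0// ltW.
pose u x : R[i] := (v x)%:C%C.
have uE x : 1 < x -> Normc.normc (u x) = v x.
  by move=> x1; rewrite normc_real ger0_norm// v0.
have gv_fin : (\int[leb]_(x in `]1%R, +oo[) (g x^-1 * v x)%:E < +oo)%E.
  by apply: le_lt_trans wv _; exact: ltry.
have domu : dom_funA g u.
  split; last first.
    apply: le_lt_trans gv_fin; rewrite le_eqVlt; apply/orP; left; apply/eqP.
    apply: eq_integral => x Dx.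
    by rewrite uE//; move: Dx; rewrite inE/= in_itv/= andbT.
  split; last exact: integrable0.
  apply/integrableP; split; first exact/measurable_EFinP.
  (* Membership in L_1 follows from v(x) <= g(1/x) v(x) / g(1). *)
  apply: (@le_lt_trans _ _ (\int[leb]_(x in `]1%R, +oo[)
      ((g 1)^-1%:E * (g x^-1 * v x)%:E))%E).
    apply: ge0_le_integral => //.
    + by apply: measurableT_comp => //; exact/measurable_EFinP.
    + apply: measurable_funeM; apply/measurable_EFinP.
      exact: measurable_funM mgV mv.
    + move=> x; rewrite /= in_itv/= andbT => x1.
      rewrite -EFinM lee_fin ger0_norm ?v0// ler_pdivlMl ?gp//.
      by rewrite ler_wpM2r ?v0 ?g1.
  rewrite ge0_integralZl//.
  + by apply: lte_mul_pinfty => //; rewrite lee_fin invr_ge0 ltW// gp.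
  + by apply/measurable_EFinP; exact: measurable_funM mgV mv.
  + move=> x; rewrite /= in_itv/= andbT => x1.
    rewrite lee_fin mulr_ge0 ?v0// ltW// gp// invr_gt0; lra.
  + by rewrite lee_fin invr_ge0 ltW// gp.
have := H u domu.
have mu : measurable_fun (`]1, +oo[ : set R) (fun s => Normc.normc (u s)).
  by apply: normc_measurable.
rewrite cesaro_integralE//.
set I := integral _ _ _.
have In (n : nat) : (n.+1%:R%:E <= I)%E.
  apply: (@le_trans _ _ (\int[leb]_(x in `]1%R, +oo[)
     ((2 ^ n.+1)%:R * n.+1%:R * g (s n)^-1 * a n *
      \1_(`[s n, 2 * s n]%classic : set R) x)%:E)%E).
    rewrite integral_indic_itv//; last by rewrite !mulr_ge0// ltW.
    rewrite lee_fin /a le_eqVlt; apply/orP; left; apply/eqP; field.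
    by rewrite !gt_eqF.
  apply: ge0_le_integral => //.
  + move=> x _; rewrite lee_fin mulr_ge0// mulr_ge0 ?(ltW (a0 n))//.
    by rewrite mulr_ge0 ?(ltW (gs n)).
  + by apply/measurable_EFinP; exact: measurable_funM.
  + by apply: emeasurable_funM; [exact: weight_cesaro_measurable|
      exact/measurable_EFinP].
  + move=> x Dx.
    have x1 : 1 < x by move: Dx; rewrite /= in_itv/= andbT.
    have W0 := weight_cesaro_ge0 gP x1.
    have [xI|xI] := pselect (`[s n, 2 * s n]%classic x); last first.
      by rewrite indicE memNset// mulr0 mule_ge0// lee_fin normc_ge0.
    have ax : a n <= v x.
      apply: le_trans (fv n x _); last by rewrite /= in_itv/= x1.
      by rewrite /f indicE mem_set// mulr1.
    rewrite indicE mem_set// mulr1 EFinM lee_pmul//.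
    + by rewrite lee_fin mulr_ge0 ?(ltW (gs n)).
    + by rewrite lee_fin ltW.
    + rewrite -(@lee_pmul2l _ 2%:E)// -EFinM.
      apply: le_trans (weight_cesaro_ge gP x1).
      apply: le_trans (weight_min_nondecreasing gP (s0 n) (_ : s n <= x));
        last first.
        by move: xI; rewrite /= in_itv/= => /andP[].
      by rewrite !mulrA; exact: ltW.
    + by rewrite lee_fin uE.
move=> Ioo.
have I0 : (0 <= I)%E by apply: le_trans (In 0%N); rewrite lee_fin.
have Ifin : I \is a fin_num by rewrite ge0_fin_numE.
(* For this index, n+1 exceeds the supposedly finite value of [I]. *)
have := In (Num.truncn (fine I)); rewrite -(fineK Ifin) lee_fin leNgt.
by rewrite truncnS_gt.
Qed.

End boundedness.

Theorem theorem4p3 (R : realType)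
    (mu : {measure set (measurableTypeR R) -> \bar R}) (g : R -> R)
    (g_stieltjes : stieltjes mu g) (g0 : g x @[x --> 0^'+] --> +oo) :
  (forall u : R -> R[i], dom_funA g u ->
     (\int[lebesgue_measure]_(t in `[1%R, +oo[)
        ((g t^-1)%:E * L1norm (cesaro_semigroup t u) * (t^-1)%:E) < +oo)%E)
  <->
  (lebesgue_measure.-integrable `]0, 1[ (EFin \o g) /\
   exists2 c : R, 0 < c &
     forall t : R, 0 < t -> t < 1 ->
       ((t^-1)%:E * (\int[lebesgue_measure]_(tau in `]0%R, t[) (g tau)%:E) +
        \int[lebesgue_measure]_(tau in `]t, 1%R[) (g tau / tau)%:E
        <= (c * g t)%:E)%E).
Proof.
have gP := stieltjes_decreasing_profile g_stieltjes g0.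
have [gp _ _] := gP.
have mg (D : set R) : measurable D -> D `<=` `]0, +oo[ ->
    measurable_fun D (EFin \o g).
  move=> mD D0; apply/measurable_EFinP; apply: continuous_pos_measurable => //.
  by move=> x; exact: decreasing_profile_continuous.
have mgV := decreasing_profile_inv_measurable gP.
split=> [H|[_ [c c0 Hc]] u [[/integrableP[/measurable_EFinP mRe _]
    /integrableP[/measurable_EFinP mIm _]] gu]].
- have [c c0 Wc] := weight_bounded gP H.
  have Hc t : 0 < t -> t < 1 ->
      ((t^-1)%:E * (\int[lebesgue_measure]_(tau in `]0%R, t[) (g tau)%:E) +
        \int[lebesgue_measure]_(tau in `]t, 1%R[) (g tau / tau)%:E
        <= (c * g t)%:E)%E.
    move=> t0 t1; rewrite -(weight_minE gP t0 t1) -[in leRHS](invrK t).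
    by apply: Wc; rewrite invf_gt1.
  split; last by exists c.
  (* The inequality at the single point t = 1/2 yields integrability on (0, 1): the first term
     controls [g] on (0, 1/2), and the second controls it on (1/2, 1) because 1/tau >= 1 there. *)
  have half0 : 0 < 2^-1 :> R by [].
  have half1 : 2^-1 < 1 :> R by lra.
  have I12 := Hc _ half0 half1.
  pose I1 := (\int[lebesgue_measure]_(x in `]0%R, (2^-1)%R[) (g x)%:E)%E.
  pose I2 := (\int[lebesgue_measure]_(x in `](2^-1)%R, 1%R[) (g x / x)%:E)%E.
  have I10 : (0 <= I1)%E.
    apply: integral_ge0 => x/=; rewrite in_itv/= => /andP[x0 _].
    by rewrite lee_fin ltW// gp.
  have I20 : (0 <= I2)%E.
    apply: integral_ge0 => x/=; rewrite in_itv/= => /andP[x0 _].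
    by rewrite lee_fin divr_ge0 ?ltW ?gp//; lra.
  have I12' : (I1 + I2 < +oo)%E.
    apply: le_lt_trans (ltry _); apply: le_trans I12; apply: leeD => //.
    by rewrite invrK -[leLHS]mul1e lee_pmul// lee_fin ler1n.
  apply/integrableP; split.
    by apply: mg => // x/=; rewrite !in_itv/= andbT => /andP[].
  apply: le_lt_trans I12'.
  have -> : (\int[lebesgue_measure]_(x in `]0%R, 1%R[) `|(EFin \o g) x| =
      \int[lebesgue_measure]_(x in `]0%R, 1%R[) (EFin \o g) x)%E.
    apply: eq_integral => x; rewrite inE/= in_itv/= => /andP[x0 _].
    by rewrite ger0_norm// ltW// gp.
  rewrite (_ : `]0, 1[%classic = `]0, 2^-1]%classic `|` `]2^-1, 1[%classic);
    last first.
    by rewrite -itv_bndbnd_setU// bnd_simp ltW.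
  rewrite ge0_integral_setU//; last 3 first.
  + apply: mg; first exact: measurableU.
    by move=> y/= []; rewrite !in_itv/=; lra.
  + move=> y/= [|]; rewrite !in_itv/= => /andP[y0 _].
      by rewrite lee_fin ltW// gp.
    by rewrite lee_fin ltW// gp//; lra.
  + apply/disj_setPS => y/= []; rewrite !in_itv/= => /andP[_ yx] /andP[xy _].
    by move: (lt_le_trans xy yx); rewrite ltxx.
  rewrite -integral_itv_bndo_bndc; last first.
    by apply: mg => // y/=; rewrite !in_itv/= andbT => /andP[].
  apply: leeD => //; apply: ge0_le_integral => //.
  + by move=> x/=; rewrite in_itv/= => /andP[hx _]; rewrite lee_fin ltW// gp//; lra.
  + by apply: mg => // y/=; rewrite !in_itv/= andbT => /andP[]; lra.
  + apply/measurable_EFinP; apply: continuous_pos_measurable => //.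
      by move=> y/=; rewrite !in_itv/= andbT => /andP[]; lra.
    move=> x x0; apply: cvgM; first exact: decreasing_profile_continuous.
    by apply: inv_continuous; rewrite gt_eqF.
  + move=> x/=; rewrite in_itv/= => /andP[hx x1].
    have x0 : 0 < x by lra.
    by rewrite lee_fin ler_pdivlMr// ler_piMr ?ltW ?gp.
- have mN := normc_measurable mRe mIm.
  rewrite cesaro_integralE//.
  apply: (@le_lt_trans _ _ (\int[lebesgue_measure]_(s in `]1%R, +oo[)
      (c%:E * (g s^-1 * Normc.normc (u s))%:E))%E).
    apply: ge0_le_integral => //.
    + move=> s Ds; rewrite mule_ge0 ?lee_fin ?normc_ge0// weight_cesaro_ge0//.
      by move: Ds; rewrite /= in_itv/= andbT.
    + by apply: emeasurable_funM; [exact: weight_cesaro_measurable|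
        exact/measurable_EFinP].
    + apply: measurable_funeM; apply/measurable_EFinP.
      exact: measurable_funM mgV mN.
    + move=> s Ds; have s1 : 1 < s by move: Ds; rewrite /= in_itv/= andbT.
      have s0 : 0 < s by lra.
      rewrite -EFinM mulrA EFinM lee_wpmul2r ?lee_fin ?normc_ge0//.
      apply: le_trans (weight_cesaro_le gP s1) _.
      (* With s read as the inverse of x = 1/s < 1, the weight becomes the left side of the
         hypothesis at t = 1/s. *)
      rewrite -[in leLHS](invrK s) weight_minE ?invr_gt0 ?invf_lt1//.
      by apply: Hc; rewrite ?invr_gt0 ?invf_lt1.
  rewrite ge0_integralZl//.
  + by apply: lte_mul_pinfty => //; rewrite lee_fin ltW.
  + by apply/measurable_EFinP; exact: measurable_funM mgV mN.
  + move=> s Ds; have s1 : 1 < s by move: Ds; rewrite /= in_itv/= andbT.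
    by rewrite lee_fin mulr_ge0 ?normc_ge0// ltW// gp// invr_gt0; lra.
  + by rewrite lee_fin ltW.
Qed.
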